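(* Let $n\ge 3$ and let $\lambda_1,\ldots,\lambda_n$ be positive integers with $\lambda_1=\max\{\lambda_1,\lambda_2,\ldots,\lambda_n\}$. If $\gcd(\lambda_1+1,\lambda_2+1,\ldots,\lambda_n+1)=m>1$ and $\lambda_1+2\le \lambda_2+\cdots+\lambda_n+n-2$, then neither $S(n;\lambda_1,\ldots,\lambda_n)$ nor $\overline{S}(n;\lambda_1,\ldots,\lambda_n)$ has a connected partition of type $(\lambda_2+\cdots+\lambda_n+n-2,\ \lambda_1+2)$; hence neither of these two graphs is $e$-positive.
   Context: All graphs are finite and simple. $P_k$ denotes the path with $k$ vertices; for $k=1$ the single vertex counts as its leaf. For $n\ge 3$ and positive integers $\lambda_1,\ldots,\lambda_n$, the sun graph $S(n;\lambda_1,\ldots,\lambda_n)$ is obtained from the cycle $C_n$ with consecutive vertices $v_1,\ldots,v_n$ and $n$ disjoint paths $P_{\lambda_1},\ldots,P_{\lambda_n}$ (disjoint from the cycle) by connecting $v_i$ by an edge to a leaf of $P_{\lambda_i}$ for every $i$. The complete sun $\overline{S}(n;\lambda_1,\ldots,\lambda_n)$ is defined in the same way with $C_n$ replaced by the complete graph $K_n$ on $v_1,\ldots,v_n$. A connected partition of a graph $G$ is a partition $\{V_1,\ldots,V_r\}$ of its vertex set such that every induced subgraph $G[V_i]$ is connected; its type is the integer partition whose parts are the sizes $|V_1|,\ldots,|V_r|$. The chromatic symmetric function of a graph $G$ with vertices $v_1,\ldots,v_d$ is $X_G=\sum_{\kappa} x_{\kappa(v_1)}\cdots x_{\kappa(v_d)}$,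 the sum over all proper colourings $\kappa:V(G)\to\mathbb{N}$, with $x_1,x_2,\ldots$ commuting variables. $G$ is $e$-positive if all coefficients of $X_G$ in the basis $\{e_\lambda\}$ of elementary symmetric functions ($e_\lambda=e_{\lambda_1}e_{\lambda_2}\cdots$) are nonnegative. *)

(* Defs.v *)
From HB Require Import structures.
From mathcomp Require Import all_boot all_order all_algebra.

Set Implicit Arguments.
Unset Strict Implicit.
Unset Printing Implicit Defensive.

Import GRing.Theory Num.Theory.

Local Open Scope nat_scope.

(** * Finite simple graphs *)

Record sgraph := SGraph {
  vertex :> finType;
  adj : rel vertex;
  adj_sym : symmetric adj;
  adj_irr : irreflexive adj
}.

Definition connected (G : sgraph) : Prop :=
  0 < #|G| /\ forall x y : G, connect (@adj G) x y.

Section Induced.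
Variables (G : sgraph) (A : {set G}).

Definition induced_rel : rel {x : G | x \in A} :=
  fun x y => adj (val x) (val y).

Lemma induced_sym : symmetric induced_rel.
Proof. by move=> x y; exact: adj_sym. Qed.

Lemma induced_irr : irreflexive induced_rel.
Proof. by move=> x; exact: adj_irr. Qed.

Definition induced : sgraph := SGraph induced_sym induced_irr.
End Induced.

(** * Connected partitions *)

Definition connected_partition (G : sgraph) (P : {set {set G}}) : Prop :=
  partition P [set: G] /\ forall A : {set G}, A \in P -> connected (induced A).

(* Integer partitions are weakly decreasing sequences of positive integers. *)
Definition is_part (la : seq nat) : bool := sorted geq la && (0 \notin la).

Definition partition_type (G : sgraph) (P : {set {set G}}) : seq nat :=
  sort geq [seq #|A| | A : {set G} <- enum P].

Definition has_connected_partition (G : sgraph) (la : seq nat) : Prop :=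
  exists P : {set {set G}}, connected_partition P /\ partition_type P = la.

(** * Suns *)

Section CycleComplete.
Variable n : nat.

(* The test [i != j] only matters for the degenerate value n = 1. *)
Definition cycle_rel : rel 'I_n :=
  fun i j => (i != j) && ((ordS i == j) || (ordS j == i)).

Lemma cycle_sym : symmetric cycle_rel.
Proof. by move=> i j; rewrite /cycle_rel eq_sym orbC. Qed.

Lemma cycle_irr : irreflexive cycle_rel.
Proof. by move=> i; rewrite /cycle_rel eqxx. Qed.

Definition cycle_graph : sgraph := SGraph cycle_sym cycle_irr.

Definition complete_rel : rel 'I_n := fun i j => i != j.

Lemma complete_sym : symmetric complete_rel.
Proof. by move=> i j; rewrite /complete_rel eq_sym. Qed.

Lemma complete_irr : irreflexive complete_rel.
Proof. by move=> i; rewrite /complete_rel eqxx. Qed.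

Definition complete_graph : sgraph := SGraph complete_sym complete_irr.
End CycleComplete.

(* [attach_paths H lam] is H together with disjoint paths P_(lam v), one for
   each vertex v of H, and an edge from v to a leaf of P_(lam v).  The vertex
   [inr (Tagged _ k)] with tag v is the k-th vertex of P_(lam v), the vertices
   of which are listed along the path starting from the leaf joined to v. *)
Section AttachPaths.
Variables (H : sgraph) (lam : H -> nat).

Definition attach_vertex : finType := (H + {v : H & 'I_(lam v)})%type.

Definition attach_rel : rel attach_vertex := fun x y =>
  match x, y with
  | inl u, inl v => adj u v
  | inl u, inr q => (u == tag q) && (tagged q == 0 :> nat)
  | inr p, inl v => (v == tag p) && (tagged p == 0 :> nat)
  | inr p, inr q => (tag p == tag q) &&
      (((tagged p).+1 == tagged q :> nat) || ((tagged q).+1 == tagged p :> nat))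
  end.

Lemma attach_sym : symmetric attach_rel.
Proof.
by move=> [u|p] [v|q] //=; [exact: adj_sym | rewrite eq_sym orbC].
Qed.

Lemma attach_irr : irreflexive attach_rel.
Proof.
move=> [u|p] /=; first exact: adj_irr.
by rewrite orbb gtn_eqF ?andbF.
Qed.

Definition attach_paths : sgraph := SGraph attach_sym attach_irr.
End AttachPaths.

(* Indices are shifted by one: [lam i] is the length attached to v_(i+1), for
   0 <= i < n; the other values of [lam] are irrelevant. *)
Definition sun (n : nat) (lam : nat -> nat) : sgraph :=
  @attach_paths (cycle_graph n) (fun i : 'I_n => lam i).

Definition complete_sun (n : nat) (lam : nat -> nat) : sgraph :=
  @attach_paths (complete_graph n) (fun i : 'I_n => lam i).

(* Imported only here: classical_sets redefines finset's [partition]. *)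
From mathcomp Require Import finmap boolp classical_sets functions cardinality.
From mathcomp Require Import fsbigop monalg.

(** * Formal power series in countably many commuting variables *)

Local Open Scope classical_set_scope.
Local Open Scope ring_scope.

(* A monomial is an element of the free commutative monoid [{cmonom nat}], in
   which [ucm i] is the variable x_i; a series is given by its coefficients.
   The ring structure that functions inherit pointwise is not the one meant
   here: the product of series is [series_mul]. *)
Definition series : Type := {cmonom nat} -> rat.

Definition series_of_monom (u : {cmonom nat}) : series :=
  fun m => (m == u)%:R.

Definition series_one : series := series_of_monom mone.

Lemma monom_prodE (T : Type) (r : seq T) (F : T -> {cmonom nat}) (i : nat) :
  (\big[mmul/mone]_(x <- r) F x) i = (\sum_(x <- r) F x i)%N.
Proof.
apply: (big_morph (fun u : {cmonom nat} => u i)) => [u v|]; first exact: cmM.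
exact: cm1.
Qed.

(* The sums over possibly infinite sets below are sums of finitely many nonzero
   terms, by the finiteness lemmas that precede them. *)
Lemma finite_divisors (m : {cmonom nat}) :
  finite_set [set u : {cmonom nat} | forall i, (u i <= m i)%N].
Proof.
pose F (f : {ffun finsupp m -> 'I_(mdeg m).+1}) : {cmonom nat} :=
  mkcmonom [fsfun i : finsupp m => (f i : nat) | 0%N].
apply: (@sub_finite_set _ _ [set F f | f in [set: _]]); last first.
  by apply: finite_image; exact: finite_finset.
move=> u /= le_um; exists [ffun i => inord (u (val i))] => //.
apply/eqP/cmP => i; rewrite /F cmE /= fsfun_ffun; case: insubP => [j _ <-|]; last first.
  rewrite memNfinsupp => /eqP mi0; have := le_um i.
  by rewrite mi0 leqn0 => /eqP.
rewrite /= ffunE inordK // ltnS (leq_trans (le_um _)) //.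
have := fsvalP j; move: (val j) => {}j jm.
by rewrite mdegE (big_fsetD1 j) //= leq_addr.
Qed.

Lemma finite_factorizations (m : {cmonom nat}) :
  finite_set [set p : {cmonom nat} * {cmonom nat} | mmul p.1 p.2 = m].
Proof.
have fin := finite_divisors m.
apply: sub_finite_set (finite_setX fin fin) => -[u v] /= <-.
by split=> i /=; rewrite cmM ?leq_addr ?leq_addl.
Qed.

Definition series_mul (f g : series) : series := fun m =>
  \sum_(p \in [set p : {cmonom nat} * {cmonom nat} | mmul p.1 p.2 = m])
     f p.1 * g p.2.

(** * Elementary symmetric functions *)

Definition monom_of_fset (S : {fset nat}) : {cmonom nat} :=
  (\big[mmul/mone]_(i <- S) ucm i).

Lemma monom_of_fset_inj : injective monom_of_fset.
Proof.
have E (S : {fset nat}) i : monom_of_fset S i = (i \in S).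
  rewrite /monom_of_fset monom_prodE.
  under eq_bigr do rewrite cmU.
  by rewrite -big_mkcond /= sum1_count count_uniq_mem ?fset_uniq.
move=> S T eqST; apply/fsetP => i.
by have /(congr1 (fun u : {cmonom nat} => u i)) := eqST; rewrite !E; do 2!case: (i \in _).
Qed.

Definition elem_sym (k : nat) : series := fun m =>
  \sum_(S \in [set S : {fset nat} | #|` S| = k])
     series_of_monom (monom_of_fset S) m.

(* e_la = e_(la_1) e_(la_2) ... *)
Definition elem_sym_part (la : seq nat) : series :=
  \big[series_mul/series_one]_(k <- la) elem_sym k.

(* [c] is the family of coefficients of [f] in the basis (e_la) indexed by
   integer partitions: f = \sum_la c_la e_la, with finitely many c_la <> 0. *)
Definition e_expansion (f : series) (c : {fsfun seq nat -> rat with 0}) : Prop :=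
  (forall la, la \in finsupp c -> is_part la) /\
  forall m, f m = \sum_(la <- finsupp c) c la * elem_sym_part la m.

Definition e_positive_series (f : series) : Prop :=
  exists c, e_expansion f c /\ forall la, 0 <= c la.

(** * The chromatic symmetric function *)

Definition proper_colouring (G : sgraph) (kappa : {ffun G -> nat}) : Prop :=
  forall x y : G, adj x y -> kappa x <> kappa y.

Definition monom_of_colouring (G : sgraph) (kappa : {ffun G -> nat}) :
    {cmonom nat} :=
  (\big[mmul/mone]_(v : G) ucm (kappa v)).

Lemma finite_colourings (G : sgraph) (m : {cmonom nat}) :
  finite_set [set kappa : {ffun G -> nat} | monom_of_colouring kappa = m].
Proof.
pose F (f : {ffun G -> option (finsupp m)}) : {ffun G -> nat} :=
  [ffun v => oapp val 0%N (f v)].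
apply: (@sub_finite_set _ _ [set F f | f in [set: _]]); last first.
  by apply: finite_image; exact: finite_finset.
move=> k /= eq_m.
exists [ffun v => insub (k v)] => //.
apply/ffunP => v; rewrite !ffunE insubT //= mem_finsupp.
by rewrite -eq_m /monom_of_colouring monom_prodE (bigD1 v) //= cmU eqxx.
Qed.

Definition chromatic_symmetric (G : sgraph) : series := fun m =>
  \sum_(kappa \in [set kappa : {ffun G -> nat} | proper_colouring kappa])
     series_of_monom (monom_of_colouring kappa) m.

Definition e_positive (G : sgraph) : Prop :=
  e_positive_series (chromatic_symmetric G).

(* Main.v *)
Require Import Defs.
From mathcomp Require Import finmap boolp classical_sets cardinality.
From mathcomp Require Import fsbigop monalg.
From mathcomp Require Import all_boot all_order all_algebra.

Set Implicit Arguments.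
Unset Strict Implicit.
Unset Printing Implicit Defensive.

Import Order.TTheory GRing.Theory Num.Theory.

(** The combinatorial half. Suppose that every block of a connected partition
is larger than every attached path. A block cannot lie inside a path, so, being
connected, it contains with each vertex of a path the base vertex v_i to which
the path hangs; as the blocks are disjoint, each block is then a union of whole
arms, an arm being v_i together with its path. Arms have lambda_i + 1 vertices,
so m divides the size of every block ([card_block_dvd]). But m divides
lambda_1 + 1 and hence not lambda_1 + 2. Only the arms enter this argument, so
it applies to the cycle and to the complete graph alike.

The passage to e-positivity is Wolfgang's theorem for types (a, b) with two
parts ([e_positive_connected_bipartition]): a connected e-positive graph G with
a + b vertices has a connected partition of type (a, b). In outline, the
coefficient of the power sum p_a p_b in X_G is a sum over bipartitions into
connected parts, and it cannot vanish if X_G is e-positive.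

Power sums are avoided as follows. Summing the coefficients of X_G over the
monomials of degree a in q variables and of degree b in r further variables
gives the sum over the sets A with a vertices of chi_A(q) chi_(V - A)(r), where
chi_A is the chromatic polynomial of G[A]. The coefficient of q r in this
polynomial is the wanted functional; it is linear in X_G. With b = 0 the
coefficient of q is the linear coefficient of chi_G instead. By
deletion-contraction, the linear coefficient of the chromatic polynomial of a
graph with d > 0 vertices has sign (-1)^(d-1), and it is nonzero exactly when
the graph is connected ([ex_chromatic_polynomial]). Hence, up to the sign
(-1)^(a+b), the functional is nonnegative on X_H for every graph H, and it is
nonzero only if there is a bipartition into connected parts.

Finally e_lambda is a positive multiple of X_H for H the disjoint union of
complete graphs with lambda_1, lambda_2, ... vertices
([elem_sym_part_chromatic]), so an e-positive X_G is a nonnegative combination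
of such X_H. As G is connected, the linear coefficient of chi_G is nonzero, so
some connected H, that is the complete graph on a + b vertices, occurs with a
positive coefficient. On it the functional does not vanish, and the other terms
cannot cancel its contribution. *)

Local Open Scope ring_scope.

(** * The linear coefficient of the chromatic polynomial *)

Definition separates (T : finType) (C : eqType) (E : seq (T * T)) (kappa : T -> C) :=
  all (fun e => kappa e.1 != kappa e.2) E.

(** Connectedness of the multigraph with vertex set T and list of edges E, by
cuts rather than by walks: cuts are transported along a contraction without any
work. *)
Definition linked (T : finType) (E : seq (T * T)) : Prop :=
  forall A : {set T}, {in E, forall e, (e.1 \in A) = (e.2 \in A)} ->
    A = set0 \/ A = setT.

Definition loopless (T : finType) (E : seq (T * T)) := all (fun e => e.1 != e.2) E.

Definition num_colourings (T : finType) (E : seq (T * T)) (q : nat) : nat :=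
  #|[set kappa : {ffun T -> 'I_q} | separates E kappa]|.

Section Contraction.
Variables (T : finType) (x y : T) (neq_yx : y != x).

(** The vertex set after contraction of the edge xy: x is removed and its edges
are moved to y. Parallel edges and loops may arise, whence the lists of
edges. *)
Definition contracted : finType := {z : T | z != x}.

Definition contract (z : T) : contracted := insubd (exist _ y neq_yx : contracted) z.

Definition contract_edges (E : seq (T * T)) : seq (contracted * contracted) :=
  [seq (contract e.1, contract e.2) | e <- E].

Lemma val_contract z : val (contract z) = if z == x then y else z.
Proof. by rewrite val_insubd; case: (z == x). Qed.

Lemma valK_contract : cancel val contract.
Proof. by move=> z; apply: val_inj; rewrite val_contract (negbTE (valP z)). Qed.

Lemma contract_ends : contract x = contract y.
Proof. by apply: val_inj; rewrite !val_contract eqxx (negbTE neq_yx). Qed.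

Lemma contract_eq u v : contract u = contract v ->
  [|| u == v, (u == x) && (v == y) | (u == y) && (v == x)].
Proof.
move/(congr1 val); rewrite !val_contract.
case: (eqVneq u x) => [->|_]; case: (eqVneq v x) => [->|_] uv; rewrite ?eqxx //.
- by rewrite uv eqxx.
- by rewrite uv eqxx orbT.
- by rewrite uv eqxx.
Qed.

Lemma card_contracted : #|contracted|.+1 = #|T|.
Proof.
rewrite card_sig -cardsT (cardsD1 x) inE add1n; congr _.+1.
by apply: eq_card => z; rewrite !inE andbT.
Qed.

(** The colourings separating E split according to whether x and y receive
distinct colours; those giving them the same colour are the colourings of the
contraction. *)
Lemma num_colourings_contract E q :
  (num_colourings ((x, y) :: E) q + num_colourings (contract_edges E) q =
   num_colourings E q)%N.
Proof.
rewrite /num_colourings addnC.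
rewrite -(cardsID [set k : {ffun T -> 'I_q} | k x == k y]
  [set k : {ffun T -> 'I_q} | separates E k]).
congr (_ + _)%N; last first.
  by apply: eq_card => k; rewrite !inE /= andbC.
pose lift (k : {ffun contracted -> 'I_q}) : {ffun T -> 'I_q} :=
  [ffun z => k (contract z)].
have lift_inj : injective lift.
  move=> k l /ffunP kl; apply/ffunP => z.
  by have := kl (val z); rewrite !ffunE valK_contract.
rewrite -(card_imset _ lift_inj); apply: eq_card => k; rewrite !inE.
apply/imsetP/andP => [[k' + ->]|[sepk kxy]].
  rewrite inE /separates all_map !ffunE contract_ends eqxx => sepk; split=> //.
  by apply: sub_all sepk => e /=; rewrite !ffunE.
have kE z : k (val (contract z)) = k z.
  by rewrite val_contract; case: eqP => // ->; rewrite (eqP kxy).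
exists [ffun z => k (val z)]; last by apply/ffunP => z; rewrite !ffunE kE.
by rewrite inE /separates all_map; apply: sub_all sepk => e /=; rewrite !ffunE !kE.
Qed.

Lemma linked_contract E : linked ((x, y) :: E) <-> linked (contract_edges E).
Proof.
split=> lE A clA.
  have [|A0|AT] := lE [set z | contract z \in A].
  - move=> e; rewrite inE !inE => /predU1P[->|eE] /=; first by rewrite contract_ends.
    apply: (clA (contract e.1, contract e.2)).
    exact: (map_f (fun e => (contract e.1, contract e.2))) eE.
  - by left; apply/setP => z; have /setP/(_ (val z)) := A0; rewrite !inE valK_contract.
  - by right; apply/setP => z; have /setP/(_ (val z)) := AT; rewrite !inE valK_contract.
have memA z : (val (contract z) \in A) = (z \in A).
  by rewrite val_contract; case: eqP => // ->; rewrite (clA (x, y)) ?mem_head.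
have [|A0|AT] := lE [set z | val z \in A].
- move=> _ /mapP[e eE ->]; rewrite !inE /= !memA.
  by apply: clA; rewrite inE eE orbT.
- by left; apply/setP => z; have /setP/(_ (contract z)) := A0; rewrite !inE memA.
- by right; apply/setP => z; have /setP/(_ (contract z)) := AT; rewrite !inE memA.
Qed.

End Contraction.

Lemma linked_cons (T : finType) (e : T * T) E : linked E -> linked (e :: E).
Proof. by move=> lE A clA; apply: lE => f fE; apply: clA; rewrite inE fE orbT. Qed.

(** The linear coefficient is controlled by deletion-contraction: contraction
removes one vertex, so in chi(G) = chi(G - e) - chi(G / e) the two linear
coefficients contribute with the same sign. For strict positivity, a loopless
contraction contributes a nonzero term; a loop in the contraction comes from an
edge parallel to e, and then G - e is still connected and loopless. *)
Lemma ex_chromatic_polynomial (T : finType) (E : seq (T * T)) :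
  exists p : {poly rat},
    [/\ forall q : nat, p.[q%:R] = (num_colourings E q)%:R,
        0 <= (-1) ^+ #|T|.-1 * p`_1,
        ~ linked E -> p`_1 = 0
      & (0 < #|T|)%N -> linked E -> loopless E -> p`_1 != 0].
Proof.
move: {2}(size E) (erefl (size E)) => n; elim: n T E => [|n IHn] T E.
  move/size0nil->; exists 'X^#|T|; rewrite coefXn; split.
  - move=> q; rewrite hornerXn /num_colourings.
    rewrite (eq_card (B := {: {ffun T -> 'I_q}})) => [|k]; last by rewrite !inE.
    by rewrite card_ffun card_ord natrX.
  - by case: eqP => [<-|]; rewrite ?mulr0 // expr0 mul1r.
  - case: eqP => // T1 []; move=> A _.
    have : (#|A| <= #|T|)%N by exact: max_card.
    rewrite -T1; case A0: #|A| => [|[|k]] // _.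
      by left; apply/eqP; rewrite -cards_eq0 A0.
    by right; apply/eqP; rewrite eqEcard subsetT cardsT -T1 A0.
  - move=> T_gt0 lE _; suff -> : #|T| = 1%N by [].
    have [v _] := card_gt0P T_gt0.
    have [|/setP/(_ v)|vT] := lE [set v]; first by [].
      by rewrite !inE eqxx.
    by rewrite -cardsT -vT cards1.
case: E => // -[x y] E [sz_E].
(* A loop excludes every colouring. *)
have [->|neq_xy] := eqVneq x y.
  exists 0; rewrite !coef0 mulr0; split=> //; last by rewrite /loopless /= eqxx.
  move=> q; rewrite horner0 /num_colourings; apply/esym/eqP.
  by rewrite pnatr_eq0 cards_eq0; apply/eqP/setP => k; rewrite !inE /= eqxx.
have neq_yx : y != x by rewrite eq_sym.
have [p1 [p1E p1_ge0 p1_0 p1_n0]] := IHn T E sz_E.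
have [|p2 [p2E p2_ge0 p2_0 p2_n0]] := IHn _ (contract_edges neq_yx E).
  by rewrite size_map.
have cardT := card_contracted x.
have T'_gt0 : (0 < #|contracted x|)%N by apply/card_gt0P; exists (contract neq_yx x).
have signE : (-1) ^+ #|T|.-1 * (p1 - p2)`_1 =
    (-1) ^+ #|T|.-1 * p1`_1 + (-1) ^+ #|contracted x|.-1 * p2`_1 :> rat.
  rewrite coefB mulrBr -cardT /=; congr (_ + _).
  by rewrite -[in LHS](prednK T'_gt0) exprS mulN1r mulNr opprK.
exists (p1 - p2); split.
- move=> q; rewrite hornerD hornerN p1E p2E -(num_colourings_contract neq_yx E q).
  by rewrite natrD addrK.
- by rewrite signE addr_ge0.
- move=> nlE; rewrite coefB p1_0 ?p2_0 ?subrr //; last by move/linked_cons.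
  by move/linked_contract.
- move=> T_gt0 lE /andP[_ llE].
  suff: 0 < (-1) ^+ #|T|.-1 * (p1 - p2)`_1.
    by move/lt0r_neq0; rewrite mulf_eq0 negb_or => /andP[].
  have pos (k : nat) (z : rat) : 0 <= (-1) ^+ k * z -> z != 0 -> 0 < (-1) ^+ k * z.
    by move=> ge0 nz; rewrite lt0r ge0 andbT mulf_neq0 // signr_eq0.
  (* If G / e has a loop, it comes from an edge uv parallel to e. *)
  rewrite signE; have [ll2|] := boolP (loopless (contract_edges neq_yx E)).
    by rewrite ltr_wpDl // pos // p2_n0 //; apply/linked_contract.
  rewrite /loopless all_map => /allPn[[u v] uvE] /=; rewrite negbK => /eqP /contract_eq.
  rewrite (negbTE (allP llE _ uvE)) /= => uvxy.
  rewrite ltr_wpDr // pos // p1_n0 // => A clA; apply: lE => e.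
  rewrite inE => /predU1P[->|]; last exact: clA.
  by have := clA _ uvE; case/orP: uvxy => /andP[/eqP-> /eqP->].
Qed.

(** * Counting proper colourings by monomials *)

Definition edges (G : sgraph) : seq (G * G) :=
  [seq e <- enum {: G * G} | adj e.1 e.2].

Lemma mem_edges (G : sgraph) (x y : G) : ((x, y) \in edges G) = adj x y.
Proof. by rewrite mem_filter mem_enum andbT. Qed.

Lemma separatesP (G : sgraph) (C : eqType) (kappa : G -> C) :
  reflect (forall x y : G, adj x y -> kappa x != kappa y) (separates (edges G) kappa).
Proof.
apply: (iffP allP) => [sep x y xy|sep [x y]]; last by rewrite mem_edges; exact: sep.
by apply: (sep (x, y)); rewrite mem_edges.
Qed.

Lemma loopless_edges (G : sgraph) : loopless (edges G).
Proof.
apply: (introT (@separatesP G G id)) => x y.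
by apply: contraTneq => ->; rewrite adj_irr.
Qed.

Definition nat_colouring (G : sgraph) N (kappa : {ffun G -> 'I_N}) : {ffun G -> nat} :=
  [ffun v => kappa v : nat].

Definition colour_monom (G : sgraph) N (kappa : {ffun G -> 'I_N}) : {cmonom nat} :=
  monom_of_colouring (nat_colouring kappa).

Lemma colour_monomE (G : sgraph) N (kappa : {ffun G -> 'I_N}) i :
  colour_monom kappa i = (\sum_v (kappa v == i :> nat))%N.
Proof.
rewrite /colour_monom /monom_of_colouring monom_prodE.
by under eq_bigr do rewrite cmU ffunE.
Qed.

Lemma colour_monom_gt0 (G : sgraph) N (kappa : {ffun G -> 'I_N}) v :
  (0 < colour_monom kappa (kappa v))%N.
Proof. by rewrite colour_monomE (bigD1 v) //= eqxx. Qed.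

Lemma ex_monom_bound (m : {cmonom nat}) : exists N, forall i, (N <= i)%N -> m i = 0%N.
Proof.
exists (\max_(i <- finsupp m) i).+1 => i le_i; apply/eqP; rewrite cmE_eq0.
apply: contraL le_i => im; rewrite -ltnNge ltnS.
by rewrite (big_rem i) //= leq_maxl.
Qed.

(** The coefficient at m counts the proper colourings with monomial m, and these
only use colours below any bound N for the variables occurring in m. *)
Lemma chromatic_symmetricE (G : sgraph) N (m : {cmonom nat}) :
  (forall i, (N <= i)%N -> m i = 0%N) ->
  chromatic_symmetric G m =
    \sum_(kappa : {ffun G -> 'I_N} | separates (edges G) kappa)
      (m == colour_monom kappa)%:R.
Proof.
move=> mN; rewrite /chromatic_symmetric.
have inj : injective (@nat_colouring G N).
  move=> k l /ffunP kl; apply/ffunP => v; apply: val_inj.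
  by have := kl v; rewrite !ffunE.
pose P (k : {ffun G -> nat}) := `[< proper_colouring k >].
have PE (k : {ffun G -> 'I_N}) : P (nat_colouring k) = separates (edges G) k.
  apply/asboolP/separatesP => prk x y /prk; rewrite !ffunE; first by move/eqP.
  by move=> /eqP + kxy; apply; apply: val_inj.
have -> : [set k | proper_colouring k]%classic = [set` P]%classic.
  by apply/seteqP; split=> k;
    [exact: (introT (asboolP _)) | exact: (elimT (asboolP _))].
rewrite -(@bigfs _ _ _ _ (map (@nat_colouring G N) (enum {: {ffun G -> 'I_N}}))).
- by rewrite big_map big_enum_cond; apply: eq_bigl => k; rewrite PE.
- by rewrite map_inj_uniq ?enum_uniq.
move=> k _ /negP kN; rewrite /series_of_monom; case: eqP => // mk; case: kN.
have kN v : (k v < N)%N.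
  rewrite ltnNge; apply/negP => /mN; rewrite mk /monom_of_colouring monom_prodE.
  by rewrite (bigD1 v) //= cmU eqxx.
apply/mapP; exists [ffun v => Ordinal (kN v)]; first by rewrite mem_enum.
by apply/ffunP => v; rewrite !ffunE.
Qed.

(** * Elementary symmetric functions as chromatic symmetric functions *)

Section DisjointUnion.
Variables G H : sgraph.

Definition union_rel : rel (G + H)%type := fun x y =>
  match x, y with
  | inl u, inl v => adj u v
  | inr u, inr v => adj u v
  | _, _ => false
  end.

Lemma union_sym : symmetric union_rel.
Proof. by move=> [u|u] [v|v] //=; exact: adj_sym. Qed.

Lemma union_irr : irreflexive union_rel.
Proof. by move=> [u|u] /=; exact: adj_irr. Qed.

Definition disjoint_union : sgraph := SGraph union_sym union_irr.

(** A proper colouring of a disjoint union is a pair of proper colourings, and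
its monomial is the product of their monomials. *)
Lemma chromatic_symmetric_union :
  chromatic_symmetric disjoint_union =
  series_mul (chromatic_symmetric G) (chromatic_symmetric H).
Proof.
apply: funext => m; have [N mN] := ex_monom_bound m.
rewrite /series_mul fsbig_finite; last exact: finite_factorizations.
set D := fset_set _.
have memD p : (p \in D) = (mmul p.1 p.2 == m).
  rewrite in_fset_set; last exact: finite_factorizations.
  by apply/asboolP/eqP.
rewrite (chromatic_symmetricE _ mN).
transitivity (\sum_(p <- D)
   \sum_(k : {ffun G -> 'I_N} | separates (edges G) k)
   \sum_(l : {ffun H -> 'I_N} | separates (edges H) l)
     (p == (colour_monom k, colour_monom l))%:R : rat); last first.
  rewrite !big_seq; apply: eq_bigr => p; rewrite memD => /eqP pm.
  have pN i : (N <= i)%N -> p.1 i = 0%N /\ p.2 i = 0%N.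
    by move/mN; rewrite -pm cmM => /eqP; rewrite addn_eq0 => /andP[/eqP-> /eqP->].
  rewrite (@chromatic_symmetricE G N) => [|i /pN[]//].
  rewrite (@chromatic_symmetricE H N) => [|i /pN[]//].
  rewrite mulr_suml; apply: eq_bigr => k _; rewrite mulr_sumr; apply: eq_bigr => l _.
  by rewrite -natrM mulnb.
rewrite exchange_big; under [RHS]eq_bigr do rewrite exchange_big.
rewrite /= pair_big /=.
pose glue (kl : {ffun G -> 'I_N} * {ffun H -> 'I_N}) : {ffun disjoint_union -> 'I_N} :=
  [ffun x => match x with inl u => kl.1 u | inr v => kl.2 v end].
rewrite (reindex glue) /=; last first.
  exists (fun k : {ffun disjoint_union -> 'I_N} =>
            ([ffun u => k (inl u)], [ffun v => k (inr v)])).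
    by move=> [k l] _; congr pair; apply/ffunP => z; rewrite !ffunE.
  by move=> k _; apply/ffunP => -[u|v]; rewrite !ffunE.
apply: eq_big => [[k l]|[k l] _] /=.
  apply/separatesP/andP => [sep|[/separatesP sepk /separatesP sepl] [u|u] [v|v] //= uv].
  - split; apply/separatesP => u v uv.
      by have := sep (inl u) (inl v) uv; rewrite !ffunE.
    by have := sep (inr u) (inr v) uv; rewrite !ffunE.
  - by rewrite !ffunE; exact: sepk.
  - by rewrite !ffunE; exact: sepl.
have -> : colour_monom (glue (k, l)) = mmul (colour_monom k) (colour_monom l).
  apply/eqP/cmP => i; rewrite cmM !colour_monomE big_sumType /=.
  by congr (_ + _)%N; apply: eq_bigr => v _; rewrite ffunE.
transitivity (((colour_monom k, colour_monom l) \in D)%:R : rat).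
  by rewrite memD eq_sym.
have [klD|klD] := boolP (_ \in _).
  rewrite (big_fsetD1 _ klD) /= eqxx big_seq big1 ?addr0 // => p.
  by rewrite in_fsetD1 => /andP[/negbTE->].
by rewrite big_seq big1 // => p pD; case: eqP klD => // <-; rewrite pD.
Qed.

End DisjointUnion.

Lemma monom_of_fsetE (S : {fset nat}) i : monom_of_fset S i = (i \in S).
Proof.
rewrite /monom_of_fset monom_prodE; under eq_bigr do rewrite cmU.
by rewrite -big_mkcond /= sum1_count count_uniq_mem ?fset_uniq.
Qed.

Lemma colour_monom_injective (G : sgraph) N (kappa : {ffun G -> 'I_N}) :
  injective kappa ->
  colour_monom kappa = monom_of_fset [fset (kappa v : nat) | v in G]%fset.
Proof.
move=> inj; apply/eqP/cmP => i; rewrite colour_monomE monom_of_fsetE.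
have [/imfsetP[v _ ->]|iN] := boolP (i \in _).
  rewrite (bigD1 v) //= eqxx big1 // => w wv; apply/eqP; rewrite eqb0.
  by apply: contra wv => /eqP /val_inj /inj ->.
rewrite big1 // => v _; apply/eqP; rewrite eqb0; apply: contra iN => /eqP <-.
by apply/imfsetP; exists v.
Qed.

(** The proper colourings of a complete graph are the injective ones, and k! of
them use a given set of k colours. *)
Lemma chromatic_symmetric_complete k m :
  chromatic_symmetric (complete_graph k) m = k`!%:R * elem_sym k m.
Proof.
have [N mN] := ex_monom_bound m; rewrite (chromatic_symmetricE _ mN).
have sepE (l : {ffun complete_graph k -> 'I_N}) :
    separates (edges (complete_graph k)) l = injectiveb l.
  apply/separatesP/injectiveP => [sep u v luv|inj u v /=]; last first.
    by apply: contra => /eqP/inj->.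
  by apply: contraPeq luv => /sep /eqP.
have card_range (l : {ffun complete_graph k -> 'I_N}) : injective l ->
    #|` [fset (l v : nat) | v in complete_graph k]%fset| = k.
  move=> inj; rewrite card_imfset /=; last by move=> u v /val_inj /inj.
  by rewrite -cardE card_ord.
have [[S [cardS mS]]|noS] := pselect (exists S : {fset nat},
    #|` S| = k /\ m = monom_of_fset S); last first.
  rewrite big1 => [|l]; last first.
    rewrite sepE => /injectiveP inj; case: eqP => // ml; case: noS.
    exists [fset (l v : nat) | v in complete_graph k]%fset.
    by rewrite card_range // ml colour_monom_injective.
  rewrite /elem_sym fsbig1 ?mulr0 // => S cardS; rewrite /series_of_monom.
  by case: eqP => // mS; case: noS; exists S.
have -> : elem_sym k m = 1.
  rewrite /elem_sym -(@fsbig_widen _ _ _ _ [set S]%classic).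
  - by rewrite fsbig_set1 /series_of_monom mS eqxx.
  - by move=> _ ->.
  move=> S' [_ /= neqS]; rewrite /series_of_monom mS.
  case: eqP => // /monom_of_fset_inj eqS.
  by case: neqS.
(* The colourings counted are the injections into A. *)
pose A := [set i : 'I_N | val i \in S].
have cardA : #|A| = k.
  have -> : k = #|` [fset nat_of_ord i | i in A]%fset|.
    rewrite -cardS; congr #|` _|; apply/fsetP => i.
    apply/idP/imfsetP => [iS|[j]]; last first.
      by rewrite /= inE => jS ->.
    have iN : (i < N)%N.
      by rewrite ltnNge; apply/negP => /mN; rewrite mS monom_of_fsetE iS.
    by exists (Ordinal iN); rewrite //= inE.
  by rewrite card_imfset /= -?cardE //; exact: val_inj.
rewrite mulr1.
transitivity
  (#|[set l : {ffun 'I_k -> 'I_N} in ffun_on A | injectiveb l]|%:R : rat);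
  last first.
  by rewrite card_inj_ffuns_on cardA card_ord ffactnn.
rewrite -sum1_card natr_sum big_mkcond [RHS]big_mkcond /=; apply: eq_bigr => l _.
rewrite sepE inE; case: injectiveP => inj; last by rewrite andbF.
rewrite andbT; have [lA|] := boolP (l \in ffun_on A).
  suff -> : m = @colour_monom (complete_graph k) N l by rewrite eqxx.
  rewrite mS (@colour_monom_injective (complete_graph k) _ _ inj); congr monom_of_fset.
  apply/eqP; rewrite eq_sym eqEfcard card_range // cardS leqnn andbT.
  apply/fsubsetP => _ /imfsetP[v _ ->].
  by have /ffun_onP/(_ v) := lA; rewrite inE.
apply: contraNeq; rewrite pnatr_eq0 eqb0 negbK => /eqP ml.
apply/ffun_onP => v; rewrite inE /=; have := @colour_monom_gt0 (complete_graph k) _ l v.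
by rewrite -ml mS monom_of_fsetE lt0b.
Qed.

Lemma chromatic_symmetric_empty (G : sgraph) : #|G| = 0%N ->
  chromatic_symmetric G = series_one.
Proof.
move=> G0; apply: funext => m; have [N mN] := ex_monom_bound m.
rewrite (chromatic_symmetricE _ mN) /series_one /series_of_monom.
have noG (v : G) : False by have := card0_eq G0 v.
pose l : {ffun G -> 'I_N} := [ffun v => match noG v with end].
have lE l' : l' = l by apply/ffunP => v; case: (noG v).
rewrite (big_pred1 l) => [|l'].
  by congr (_ == _)%:R; apply/eqP/cmP => i; rewrite colour_monomE cm1 big1.
by rewrite /= (lE l') eqxx; apply/separatesP => v; case: (noG v).
Qed.

Lemma series_mulZ c d (f g : series) :
  series_mul (fun m => c * f m) (fun m => d * g m) =
  (fun m => c * d * series_mul f g m).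
Proof.
apply: funext => m; rewrite /series_mul mulr_fsumr; apply: eq_fsbigr => p _.
by rewrite mulrACA.
Qed.

Lemma not_linked_union (G H : sgraph) : (0 < #|G|)%N -> (0 < #|H|)%N ->
  ~ linked (edges (disjoint_union G H)).
Proof.
move=> /card_gt0P[u _] /card_gt0P[v _] lE.
pose A : {set disjoint_union G H} :=
  [set x : G + H | if x is inl _ then true else false].
have [|A0|AT] := lE A.
- by move=> [[x|x] [y|y]]; rewrite mem_edges !inE.
- by have /setP/(_ (inl u)) := A0; rewrite !inE.
- by have /setP/(_ (inr v)) := AT; rewrite !inE.
Qed.

(** H is the disjoint union of complete graphs whose orders are the parts of la,
and c is the inverse of the product of the factorials of the parts. *)
Lemma elem_sym_part_chromatic (la : seq nat) : 0%N \notin la ->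
  exists (H : sgraph) (c : rat),
    [/\ 0 < c, elem_sym_part la = (fun m => c * chromatic_symmetric H m),
        #|H| = sumn la,
        (1 < size la)%N -> ~ linked (edges H)
      & (size la <= 1)%N -> forall x y : H, adj x y = (x != y)].
Proof.
elim: la => [_|k la IH].
  exists (complete_graph 0), 1; split=> //; last by rewrite card_ord.
  apply: funext => m; rewrite mul1r chromatic_symmetric_empty ?card_ord //.
  by rewrite /elem_sym_part big_nil.
rewrite inE negb_or => /andP[k_n0 /[dup] la_n0 /IH[H [c [c_gt0 laE cardH _ _]]]].
exists (disjoint_union (complete_graph k) H), (c / k`!%:R).
have k_gt0 : 0 < k`!%:R :> rat by rewrite ltr0n fact_gt0.
split=> //.
- by rewrite divr_gt0.
- rewrite {1}/elem_sym_part big_cons -/(elem_sym_part la) laE.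
  have -> : elem_sym k =
      (fun m => k`!%:R^-1 * chromatic_symmetric (complete_graph k) m).
    by apply: funext => m; rewrite chromatic_symmetric_complete mulKf // gt_eqF.
  by rewrite series_mulZ chromatic_symmetric_union mulrC.
- by rewrite card_sum card_ord cardH.
- case: la la_n0 cardH {IH laE} => // i la.
  rewrite inE negb_or => /andP[i_n0 _] cardH _.
  apply: not_linked_union; first by rewrite card_ord lt0n eq_sym.
  by rewrite cardH /= addn_gt0 lt0n eq_sym i_n0.
case: la la_n0 cardH {IH laE} => // _ /card0_eq noH _ [u|u] [v|v] //.
- by have := noH v.
- by have := noH u.
- by have := noH u.
Qed.

(** * Coefficients of polynomials in two variables *)

Lemma poly_eq_on (R : idomainType) (u : nat -> R) (p q : {poly R}) :
  injective u -> (forall n, p.[u n] = q.[u n]) -> p = q.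
Proof.
move=> inj_u pq; apply/eqP; rewrite -subr_eq0; apply/negPn/negP => pq_n0.
have all_roots : all (root (p - q)) (mkseq u (size (p - q))).
  by apply/allP => _ /mapP[n _ ->]; rewrite /root hornerD hornerN pq subrr.
have := max_poly_roots pq_n0 all_roots (mkseq_uniq _ inj_u).
by rewrite size_mkseq ltnn.
Qed.

Lemma natr_inj : injective (fun n : nat => n%:R : rat).
Proof. by move=> m n /eqP; rewrite eqr_nat => /eqP. Qed.

(** z is the coefficient of q^i r^j in the polynomial B with values F. The inner
variable of B is r. *)
Definition has_coef (i j : nat) (F : nat -> nat -> rat) (z : rat) : Prop :=
  exists B : {poly {poly rat}},
    (forall q r : nat, F q r = B.[q%:R%:P].[r%:R]) /\ z = B`_i`_j.

(** A polynomial is determined by its values at pairs of natural numbers. *)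
Lemma has_coef_inj i j F z w : has_coef i j F z -> has_coef i j F w -> z = w.
Proof.
move=> [B [FB ->]] [C [FC ->]]; suff -> : B = C by [].
apply: (@poly_eq_on _ (fun n => n%:R%:P)) => [m n /polyC_inj/natr_inj//|q].
by apply: (poly_eq_on natr_inj) => r; rewrite -FB.
Qed.

Lemma has_coef_mul i j (p s : {poly rat}) :
  has_coef i j (fun q r => p.[q%:R] * s.[r%:R]) (p`_i * s`_j).
Proof.
exists (map_poly polyC p * s%:P); split=> [q r|].
  by rewrite hornerM hornerC horner_map hornerM hornerC.
by rewrite coefMC coef_map coefCM.
Qed.

Lemma has_coefZ i j c F z :
  has_coef i j F z -> has_coef i j (fun q r => c * F q r) (c * z).
Proof.
move=> [B [FB ->]]; exists (c%:P *: B); split=> [q r|]; last by rewrite coefZ coefCM.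
by rewrite hornerZ hornerM hornerC FB.
Qed.

Lemma has_coef_sum i j (I : eqType) (s : seq I) (P : pred I)
    (F : I -> nat -> nat -> rat) z :
  (forall x, x \in s -> P x -> has_coef i j (F x) (z x)) ->
  has_coef i j (fun q r => \sum_(x <- s | P x) F x q r) (\sum_(x <- s | P x) z x).
Proof.
elim: s => [_|x s IH Fz].
  by exists 0; rewrite big_nil !coef0; split=> // q r; rewrite !horner0 big_nil.
have [B [FB zB]] : has_coef i j (fun q r => \sum_(x <- s | P x) F x q r)
    (\sum_(x <- s | P x) z x).
  by apply: IH => y ys; apply: Fz; rewrite inE ys orbT.
have [Px|nPx] := boolP (P x); last first.
  by exists B; split=> [q r|]; rewrite big_cons (negbTE nPx).
have [C [FC zC]] := Fz x (mem_head _ _) Px.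
exists (C + B); split=> [q r|]; rewrite big_cons Px ?coefD ?zC ?zB //.
by rewrite !hornerD FC FB.
Qed.

(** * Splitting the variables into two groups *)

Definition bihomogeneous (q r a b : nat) : set {cmonom nat} :=
  [set m | [/\ forall i, (q + r <= i)%N -> m i = 0%N,
      (\sum_(0 <= i < q) m i)%N = a & (\sum_(q <= i < q + r) m i)%N = b]]%classic.

(** All these monomials divide (x_0 ... x_(q+r-1))^(a+b). *)
Lemma finite_bihomogeneous q r a b : finite_set (bihomogeneous q r a b).
Proof.
pose u : {cmonom nat} :=
  \big[mmul/mone]_(j < a + b) \big[mmul/mone]_(0 <= i < q + r) ucm i.
apply: sub_finite_set (finite_divisors u) => m [m0 ma mb] i /=.
have [/m0->//|i_lt] := leqP (q + r) i.
have -> : u i = (a + b)%N.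
  rewrite /u monom_prodE (eq_bigr (fun=> 1%N)) ?sum1_card ?card_ord // => j _.
  rewrite monom_prodE (bigD1_seq i) ?iota_uniq ?mem_index_iota //= cmUU big1 // => k.
  by rewrite cmU => /negbTE->.
rewrite -ma -mb -big_cat_nat ?leq_addr //.
by rewrite (bigD1_seq i) ?iota_uniq ?mem_index_iota //= leq_addr.
Qed.

(** The value at x_i = 1 of the part of f of bidegree (a, b), after the variables
beyond the first q + r are set to 0. *)
Definition bidegree_sum (q r a b : nat) (f : series) : rat :=
  \sum_(m <- fset_set (bihomogeneous q r a b)) f m.

Lemma bidegree_sumZ q r a b c f :
  bidegree_sum q r a b (fun m => c * f m) = c * bidegree_sum q r a b f.
Proof. by rewrite /bidegree_sum mulr_sumr. Qed.

Lemma bihomogeneous_colour_monom (G : sgraph) q r a b (k : {ffun G -> 'I_(q + r)}) :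
  (colour_monom k \in fset_set (bihomogeneous q r a b)) =
  (#|[set v | (k v < q)%N]| == a) && (#|[set v | (q <= k v)%N]| == b).
Proof.
have sumE m n : (\sum_(m <= i < n) colour_monom k i)%N = #|[set v | (m <= k v < n)%N]|.
  under eq_bigr do rewrite colour_monomE.
  rewrite exchange_big /= -sum1_card [RHS]big_mkcond /=; apply: eq_bigr => v _.
  rewrite inE; case: ifP => [kv|/negP kv].
    rewrite (bigD1_seq (k v : nat)) ?iota_uniq ?mem_index_iota //= eqxx big1 // => i.
    by rewrite eq_sym => /negbTE->.
  rewrite big_seq big1 // => i; rewrite mem_index_iota => i_mn; apply/eqP; rewrite eqb0.
  by apply/eqP => kvi; apply: kv; rewrite kvi.
rewrite in_fset_set; last exact: finite_bihomogeneous.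
have -> : #|[set v | (k v < q)%N]| = (\sum_(0 <= i < q) colour_monom k i)%N.
  by rewrite sumE.
have -> : #|[set v | (q <= k v)%N]| = (\sum_(q <= i < q + r) colour_monom k i)%N.
  by rewrite sumE; apply: eq_card => v; rewrite !inE ltn_ord andbT.
apply/asboolP/andP => [[_ -> ->]//|[/eqP ha /eqP hb]]; split=> // i le_i.
rewrite colour_monomE big1 // => v _; apply/eqP; rewrite eqb0 neq_ltn.
by rewrite (leq_trans (ltn_ord _)).
Qed.

Section Split.
Variables (G : sgraph) (A : {set G}).

Definition side (v : G) : {x : G | x \in A} + {x : G | x \in ~: A} :=
  match sumbool_of_bool (v \in A) with
  | left vA => inl (exist _ v vA)
  | right vA => inr (exist _ v (etrans (in_setC v A) (congr1 negb vA)))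
  end.

Lemma side_in (u : {x : G | x \in A}) : side (val u) = inl u.
Proof.
rewrite /side; case: sumbool_of_bool => uA; first by congr inl; apply: val_inj.
by have uA' := valP u; exfalso; rewrite uA in uA'.
Qed.

Lemma side_out (u : {x : G | x \in ~: A}) : side (val u) = inr u.
Proof.
rewrite /side; case: sumbool_of_bool => uA; last by congr inr; apply: val_inj.
by have uA' := valP u; exfalso; rewrite inE uA in uA'.
Qed.

Lemma sideP (v : G) :
  (exists u : induced A, v = val u) \/ (exists u : induced (~: A), v = val u).
Proof.
have [vA|] := boolP (v \in A); first by left; exists (exist _ v vA).
by rewrite -in_setC => vA; right; exists (exist _ v vA).
Qed.

(** Once A is fixed as the set of vertices with a colour below q, the two sides
are coloured independently: edges between A and its complement are separated
automatically. *)
Lemma num_colourings_split q r :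
  #|[set k : {ffun G -> 'I_(q + r)} |
      separates (edges G) k && ([set v | (k v < q)%N] == A)]| =
  (num_colourings (edges (induced A)) q *
   num_colourings (edges (induced (~: A))) r)%N.
Proof.
rewrite /num_colourings -cardsX.
pose glue (kl : {ffun induced A -> 'I_q} * {ffun induced (~: A) -> 'I_r}) :
    {ffun G -> 'I_(q + r)} :=
  [ffun v => match side v with
             | inl u => lshift r (kl.1 u)
             | inr u => rshift q (kl.2 u)
             end].
have glue_in kl u : glue kl (val u) = lshift r (kl.1 u) by rewrite ffunE side_in.
have glue_out kl u : glue kl (val u) = rshift q (kl.2 u) by rewrite ffunE side_out.
have glue_inj : injective glue.
  move=> kl kl' eq_kl; rewrite [kl]surjective_pairing [kl']surjective_pairing.
  congr pair; apply/ffunP => u; have /ffunP/(_ (val u)) := eq_kl.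
    by rewrite !glue_in => /lshift_inj.
  by rewrite !glue_out => /rshift_inj.
rewrite -(card_imset _ glue_inj); apply: eq_card => k; rewrite inE.
apply/andP/imsetP => [[/separatesP sepk /eqP kA]|[kl]].
  have memA v : (v \in A) = (k v < q)%N by rewrite -kA inE.
  have kin (u : induced A) : (k (val u) < q)%N by rewrite -memA; exact: valP u.
  have q_le (u : induced (~: A)) : (q <= k (val u))%N.
    by rewrite leqNgt -memA -in_setC; exact: valP u.
  have kout (u : induced (~: A)) : (k (val u) - q < r)%N by rewrite ltn_subLR.
  exists ([ffun u => Ordinal (kin u)], [ffun u => Ordinal (kout u)]).
    rewrite inE /= !inE; apply/andP.
    split; apply/separatesP => u v /sepk; apply: contra.
      by rewrite !ffunE => /eqP[] /val_inj ->.
    rewrite !ffunE => /eqP[] kuv; apply/eqP/val_inj.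
    by rewrite /= -(subnKC (q_le u)) -(subnKC (q_le v)) kuv.
  apply/ffunP => v; apply: val_inj; have [[u ->]|[u ->]] := sideP v.
    by rewrite glue_in ffunE.
  by rewrite glue_out ffunE /=; exact/esym/subnKC/q_le.
case: kl => k1 k2; rewrite inE /= !inE => /andP[/separatesP sep1 /separatesP sep2] ->.
split; last first.
  apply/eqP/setP => v; rewrite inE; have [[u ->]|[u ->]] := sideP v.
    by rewrite glue_in /= ltn_ord; apply/esym; exact: valP u.
  rewrite glue_out /= ltnNge leq_addr /=; apply/esym/negbTE.
  by rewrite -in_setC; exact: valP u.
apply/separatesP => x y.
have [[u ->]|[u ->]] := sideP x; have [[w ->]|[w ->]] := sideP y => xy.
- by rewrite !glue_in (inj_eq (@lshift_inj _ _)) sep1.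
- by rewrite glue_in glue_out eq_lrshift.
- by rewrite glue_in glue_out eq_rlshift.
- by rewrite !glue_out (inj_eq (@rshift_inj _ _)) sep2.
Qed.
End Split.

Lemma bidegree_sum_chromatic (G : sgraph) q r a b :
  bidegree_sum q r a b (chromatic_symmetric G) =
  \sum_(A : {set G} | (#|A| == a) && (#|~: A| == b))
    (num_colourings (edges (induced A)) q)%:R *
    (num_colourings (edges (induced (~: A))) r)%:R.
Proof.
transitivity (\sum_(k : {ffun G -> 'I_(q + r)} | separates (edges G) k)
    (colour_monom k \in fset_set (bihomogeneous q r a b))%:R : rat).
  rewrite /bidegree_sum big_seq.
  rewrite (eq_bigr (fun m =>
      \sum_(k : {ffun G -> 'I_(q + r)} | separates (edges G) k)
         (m == colour_monom k)%:R)) => [|m]; last first.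
    rewrite in_fset_set; last exact: finite_bihomogeneous.
    by move/asboolP => [m0 _ _]; exact: chromatic_symmetricE.
  rewrite -big_seq exchange_big; apply: eq_bigr => k _ /=.
  have [kD|kD] := boolP (_ \in _).
    rewrite (big_fsetD1 _ kD) /= eqxx big_seq big1 ?addr0 // => m.
    by rewrite in_fsetD1 => /andP[/negbTE->].
  by rewrite big_seq big1 // => m mD; case: eqP kD => // <-; rewrite mD.
under [RHS]eq_bigr do rewrite -natrM -num_colourings_split.
rewrite -!natr_sum; congr _%:R.
rewrite (partition_big
  (fun k : {ffun G -> 'I_(q + r)} => [set v | (k v < q)%N]) xpredT) //=.
rewrite [RHS]big_mkcond; apply: eq_bigr => A _ /=.
rewrite (eq_bigr (fun=> ((#|A| == a) && (#|~: A| == b) : nat))) => [|k]; last first.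
  move=> /andP[_ /eqP kA]; rewrite bihomogeneous_colour_monom -kA.
  congr (nat_of_bool (_ && (_ == _))).
  by apply: eq_card => v; rewrite !inE leqNgt.
case: ifP => cA; last by rewrite big1.
by rewrite sum1dep_card.
Qed.

(** * Connected bipartitions of e-positive graphs *)

Definition chromatic_polynomial (G : sgraph) : {poly rat} :=
  sval (cid (ex_chromatic_polynomial (edges G))).

Lemma chromatic_polynomialE (G : sgraph) (q : nat) :
  (chromatic_polynomial G).[q%:R] = (num_colourings (edges G) q)%:R.
Proof. by rewrite /chromatic_polynomial; case: cid => p []. Qed.

Lemma linear_coef_sign (G : sgraph) :
  0 <= (-1) ^+ #|G|.-1 * (chromatic_polynomial G)`_1.
Proof. by rewrite /chromatic_polynomial; case: cid => p []. Qed.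

Lemma linear_coef_neq0 (G : sgraph) : (0 < #|G|)%N ->
  (chromatic_polynomial G)`_1 != 0 <-> linked (edges G).
Proof.
rewrite /chromatic_polynomial; case: cid => p [_ _ p0 pn0] /= G_gt0; split.
  by move=> /eqP p1; apply: contrapT => /p0.
by move=> lG; exact: pn0 (loopless_edges G).
Qed.

(** The coefficient of q^i r^j in the sum of X_G over bidegree (a, b). For
i = j = 1 and a, b > 0 this is, up to a positive factor, the coefficient of
p_a p_b in X_G; for i = 1 and j = b = 0 it is the linear coefficient of the
chromatic polynomial if G has a vertices. *)
Definition mixed_coef (i j a b : nat) (G : sgraph) : rat :=
  \sum_(A : {set G} | (#|A| == a) && (#|~: A| == b))
    (chromatic_polynomial (induced A))`_i *
    (chromatic_polynomial (induced (~: A)))`_j.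

Lemma has_coef_chromatic i j a b (G : sgraph) :
  has_coef i j (fun q r => bidegree_sum q r a b (chromatic_symmetric G))
    (mixed_coef i j a b G).
Proof.
rewrite /mixed_coef; have [B [FB ->]] := has_coef_sum
  (fun A (_ : A \in index_enum {set G})
       (_ : (#|A| == a) && (#|~: A| == b)) =>
     has_coef_mul i j (chromatic_polynomial (induced A))
       (chromatic_polynomial (induced (~: A)))).
exists B; split=> // q r; rewrite -FB bidegree_sum_chromatic.
by apply: eq_bigr => A _; rewrite !chromatic_polynomialE.
Qed.

Lemma card_induced (G : sgraph) (A : {set G}) : #|induced A| = #|A|.
Proof. by rewrite card_sig; apply: eq_card => x; rewrite !inE. Qed.

Lemma linked_connected (G : sgraph) : (0 < #|G|)%N -> linked (edges G) -> connected G.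
Proof.
move=> G_gt0 lG; split=> // x y.
have [|/setP/(_ x)|/setP/(_ y)] := lG [set z | connect (@adj G) x z].
- move=> [u v]; rewrite mem_edges /= !inE => uv.
  have xsym : connect_sym (@adj G) by exact/sym_connect_sym/adj_sym.
  by rewrite [LHS]xsym [RHS]xsym; apply/same_connect/connect1.
- by rewrite !inE connect0.
- by rewrite !inE.
Qed.

Lemma linked_induced_setT (G : sgraph) :
  linked (edges (induced [set: G])) <-> linked (edges G).
Proof.
pose f (x : G) : induced [set: G] := exist _ x (in_setT x).
have fK (u : induced [set: G]) : f (val u) = u by exact: val_inj.
split=> lG A clA.
  have [|A0|AT] := lG [set u | val u \in A].
  - move=> [u v]; rewrite mem_edges !inE => uv.
    by apply: (clA (val u, val v)); rewrite mem_edges.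
  - by left; apply/setP => x; have /setP/(_ (f x)) := A0; rewrite !inE.
  - by right; apply/setP => x; have /setP/(_ (f x)) := AT; rewrite !inE.
have [|A0|AT] := lG [set x | f x \in A].
- move=> [u v]; rewrite mem_edges !inE => uv.
  by apply: (clA (f u, f v)); rewrite mem_edges.
- by left; apply/setP => x; have /setP/(_ (val x)) := A0; rewrite !inE fK.
- by right; apply/setP => x; have /setP/(_ (val x)) := AT; rewrite !inE fK.
Qed.

Lemma linked_complete (G : sgraph) (A : {set G}) :
  (forall x y : G, adj x y = (x != y)) -> linked (edges (induced A)).
Proof.
move=> adjE B clB; have [->|[u uB]] := set_0Vmem B; [by left | right].
apply/setP => v; rewrite inE; have [<-//|uv] := eqVneq u v.
rewrite -(clB (u, v)) ?mem_edges //= /induced_rel adjE.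
by rewrite (inj_eq val_inj).
Qed.

(** Only A = V contributes, with the constant polynomial 1 on the empty side. *)
Lemma mixed_coef10 d (G : sgraph) : (0 < d)%N ->
  mixed_coef 1 0 d 0 G != 0 <-> #|G| = d /\ linked (edges G).
Proof.
move=> d_gt0; rewrite /mixed_coef.
have [Gd|Gd] := eqVneq #|G| d; last first.
  rewrite big1 ?eqxx => [|A /andP[/eqP Ad /eqP CA]].
    by split=> // -[] /eqP; rewrite (negbTE Gd).
  by move: Gd; rewrite -(cardsC A) Ad CA addn0 eqxx.
rewrite (big_pred1 [set: G]) => [|A]; last first.
  apply/andP/eqP => [[_]|->]; last by rewrite setCT cards0 cardsT Gd !eqxx.
  by rewrite cards_eq0 => /eqP CA; rewrite -[A]setCK CA setC0.
have -> : (chromatic_polynomial (induced (~: [set: G])))`_0 = 1.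
  rewrite -horner_coef0 -[0]/(0%:R) chromatic_polynomialE /num_colourings.
  have noV (v : induced (~: [set: G])) : False by case: v => x; rewrite setCT inE.
  rewrite (eq_card (B := {: {ffun induced (~: [set: G]) -> 'I_0}})) => [|k]; last first.
    by rewrite !inE; apply/separatesP => v; case: (noV v).
  by rewrite card_ffun card_ord card_induced setCT cards0.
rewrite mulr1 linear_coef_neq0 ?card_induced ?cardsT ?Gd // linked_induced_setT.
by split=> [|[]].
Qed.

Section Mixed11.
Variables (a b : nat).
Let s : rat := (-1) ^+ (a.-1 + b.-1).

Lemma mixed_coef11_sign (G : sgraph) : 0 <= s * mixed_coef 1 1 a b G.
Proof.
rewrite /mixed_coef mulr_sumr; apply: sumr_ge0 => A /andP[/eqP Aa /eqP Ab].
rewrite /s exprD mulrACA -Aa -Ab -!card_induced.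
by rewrite mulr_ge0 ?linear_coef_sign.
Qed.

Lemma mixed_coef11_neq0 (G : sgraph) : (0 < a)%N -> (0 < b)%N ->
  mixed_coef 1 1 a b G != 0 ->
  exists A : {set G}, [/\ #|A| = a, #|~: A| = b,
    connected (induced A) & connected (induced (~: A))].
Proof.
move=> a_gt0 b_gt0 /eqP nz; apply: contrapT => noA; apply: nz.
rewrite /mixed_coef big1 // => A /andP[/eqP Aa /eqP Ab]; apply: contrapT => /eqP.
rewrite mulf_eq0 negb_or => /andP[].
have A_gt0 : (0 < #|induced A|)%N by rewrite card_induced Aa.
have C_gt0 : (0 < #|induced (~: A)|)%N by rewrite card_induced Ab.
move=> /(linear_coef_neq0 A_gt0) lA /(linear_coef_neq0 C_gt0) lC; apply: noA.
by exists A; split=> //; exact: linked_connected.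
Qed.

Lemma mixed_coef11_complete (G : sgraph) : (0 < a)%N -> (0 < b)%N ->
  #|G| = (a + b)%N -> (forall x y : G, adj x y = (x != y)) ->
  0 < s * mixed_coef 1 1 a b G.
Proof.
move=> a_gt0 b_gt0 Gab adjE.
pose A : {set G} := [set x in take a (enum G)].
have Aa : #|A| = a.
  rewrite cardsE (card_uniqP _) ?take_uniq ?enum_uniq // size_take -cardE Gab.
  by rewrite -[X in (X < _)%N]addn0 ltn_add2l b_gt0.
have Ab : #|~: A| = b by apply/(@addnI a); rewrite -{1}Aa cardsC.
rewrite /mixed_coef mulr_sumr (bigD1 A) /=; last by rewrite Aa Ab !eqxx.
apply: ltr_pwDl; last first.
  apply: sumr_ge0 => B /andP[/andP[/eqP Ba /eqP Bb] _].
  by rewrite /s exprD mulrACA -Ba -Bb -!card_induced mulr_ge0 ?linear_coef_sign.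
rewrite /s exprD mulrACA -[in _ ^+ a.-1]Aa -[in _ ^+ b.-1]Ab -!card_induced.
by rewrite mulr_gt0 // lt0r linear_coef_sign andbT mulf_neq0 ?signr_eq0 //;
  apply/linear_coef_neq0; rewrite ?card_induced ?Aa ?Ab //; exact: linked_complete.
Qed.
End Mixed11.

(** Wolfgang's theorem for partitions with two parts. *)
Theorem e_positive_connected_bipartition (G : sgraph) (a b : nat) :
  (0 < a)%N -> (0 < b)%N -> #|G| = (a + b)%N -> linked (edges G) -> e_positive G ->
  exists A : {set G}, [/\ #|A| = a, #|~: A| = b,
    connected (induced A) & connected (induced (~: A))].
Proof.
move=> a_gt0 b_gt0 Gab lG [c [[cpart XG] c_ge0]].
have /choice[rep repP] : forall la, exists Hw : sgraph * rat, la \in finsupp c ->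
    [/\ 0 < Hw.2,
        elem_sym_part la = (fun m => Hw.2 * chromatic_symmetric Hw.1 m),
        #|Hw.1| = sumn la,
        (1 < size la)%N -> ~ linked (edges Hw.1)
      & (size la <= 1)%N -> forall x y : Hw.1, adj x y = (x != y)].
  move=> la; have [/cpart/andP[_ la_n0]|la_c] := boolP (la \in finsupp c);
    last by exists (G, 0).
  by have [H [w Hw]] := elem_sym_part_chromatic la_n0; exists (H, w).
(* By uniqueness of coefficients, the expansion of X_G passes to them. *)
have coefE i j a' b' : mixed_coef i j a' b' G =
    \sum_(la <- finsupp c) c la * ((rep la).2 * mixed_coef i j a' b' (rep la).1).
  apply: has_coef_inj (has_coef_chromatic i j a' b' G) _.
  have [B [FB ->]] := has_coef_sum (P := xpredT)
    (fun la (_ : la \in finsupp c) _ => has_coefZ (c la) (has_coefZ (rep la).2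
      (has_coef_chromatic i j a' b' (rep la).1))).
  exists B; split=> // q r; rewrite -FB {1}/bidegree_sum.
  under eq_bigr do rewrite XG.
  rewrite exchange_big /= !big_seq; apply: eq_bigr => la /repP[_ laE _ _ _].
  by rewrite -mulr_sumr laE -/(bidegree_sum q r a' b' _) bidegree_sumZ.
have d_gt0 : (0 < a + b)%N by rewrite addn_gt0 a_gt0.
(* Since G is connected, so is the graph of some la in the expansion. *)
have [la la_c [la_d la_l]] : exists2 la, la \in finsupp c &
    #|(rep la).1| = (a + b)%N /\ linked (edges (rep la).1).
  have : mixed_coef 1 0 (a + b) 0 G != 0 by apply/mixed_coef10.
  rewrite coefE; apply: contra_neqP => /forall2NP nola.
  rewrite big_seq big1 // => la la_c; suff -> : mixed_coef 1 0 (a + b) 0 (rep la).1 = 0.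
    by rewrite !mulr0.
  by apply/eqP/negPn/negP => /(mixed_coef10 _ d_gt0) ?; case: (nola la).
have [w_gt0 _ _ la_nl la_complete] := repP la la_c.
have la_size : (size la <= 1)%N by rewrite leqNgt; apply/negP => /la_nl.
apply: mixed_coef11_neq0 => //.
suff : 0 < (-1) ^+ (a.-1 + b.-1) * mixed_coef 1 1 a b G.
  by apply: contraTneq => ->; rewrite mulr0 ltxx.
(* The graph of la is complete and contributes strictly. *)
rewrite coefE mulr_sumr (big_fsetD1 _ la_c) /=.
apply: ltr_pwDl.
  have c_gt0 : 0 < c la by rewrite lt0r c_ge0 andbT -mem_finsupp.
  rewrite mulrCA mulr_gt0 // mulrCA mulr_gt0 //.
  by apply: mixed_coef11_complete => //; exact: la_complete.
rewrite big_seq; apply: sumr_ge0 => mu.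
rewrite in_fsetD1 => /andP[_ /repP[w'_gt0 _ _ _ _]].
rewrite mulrCA mulr_ge0 // mulrCA; apply: mulr_ge0; first exact: ltW.
exact: mixed_coef11_sign.
Qed.

Lemma has_connected_bipartition (G : sgraph) (A : {set G}) (a b : nat) :
  (0 < b <= a)%N -> #|A| = a -> #|~: A| = b ->
  connected (induced A) -> connected (induced (~: A)) ->
  has_connected_partition G [:: a; b].
Proof.
move=> /andP[b_gt0 le_ba] Aa Ab cA cC; exists [set A; ~: A].
have neqA : A != ~: A.
  have [x xA] : exists x, x \in A by apply/card_gt0P; rewrite Aa (leq_trans b_gt0).
  by apply/eqP => /setP/(_ x); rewrite inE xA.
split; [split|].
- apply/and3P; split.
  + by rewrite /cover bigcup_setU !big_set1 setUCr.
  + apply/trivIsetP => B C; rewrite !inE.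
    move=> /orP[] /eqP-> /orP[] /eqP->; rewrite ?eqxx // => _.
      by rewrite -setI_eq0 setICr.
    by rewrite -setI_eq0 setIC setICr.
  + rewrite !inE negb_or; apply/andP; split; rewrite eq_sym -cards_eq0 -lt0n ?Ab //.
    by rewrite Aa (leq_trans b_gt0).
- by move=> B; rewrite !inE => /orP[] /eqP->.
have geq_total : total geq by move=> m n; exact: leq_total.
have geq_trans : transitive geq by move=> m n p mn nm; exact: leq_trans nm mn.
have geq_anti : antisymmetric geq by move=> m n; rewrite andbC => /anti_leq.
rewrite -[RHS](sorted_sort geq_trans) /= ?andbT //; apply/perm_sortP => //.
rewrite -Aa -Ab -[X in perm_eq _ X]/(map (fun B : {set G} => #|B|) [:: A; ~: A]).
apply/perm_map/uniq_perm; rewrite ?enum_uniq //= ?inE ?neqA // => B.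
by rewrite mem_enum !inE.
Qed.

Local Close Scope ring_scope.

(** * Connected partitions of graphs with attached paths *)

Lemma connected_sub (G : sgraph) (B C : {set G}) :
  connected (induced B) ->
  (forall x y, x \in B -> y \in B -> adj x y -> x \in C -> y \in C) ->
  (exists2 x, x \in B & x \in C) -> B \subset C.
Proof.
move=> [_ conB] clC [x xB xC]; apply/subsetP => y yB.
pose D : pred (induced B) := fun u => val u \in C.
have clD : closed (@adj (induced B)) D.
  apply: intro_closed => [|u v uv]; first exact/sym_connect_sym/adj_sym.
  by apply: clC uv; [exact: valP u|exact: valP v].
have : D (exist _ x xB) = D (exist _ y yB) := closed_connect clD (conB _ _).
by rewrite /D /= xC => <-.
Qed.

Section AttachedPaths.
Variables (H : sgraph) (lam : H -> nat).
Let G : sgraph := attach_paths lam.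

Definition base_vertex (x : G) : H := match x with inl i => i | inr p => tag p end.

Definition root_of (x : G) : G := (inl (base_vertex x) : attach_vertex lam).

(** The hypothesis says that B is a union of arms, the arm of i being i together
with the path attached to it. *)
Lemma card_saturated (B : {set G}) :
  (forall x, (x \in B) = (root_of x \in B)) ->
  #|B| = \sum_(i | (inl i : attach_vertex lam) \in B) (lam i).+1.
Proof.
move=> satB; rewrite -sum1_card big_sumType /=.
under [RHS]eq_bigr do rewrite -addn1 addnC.
rewrite big_split /=; congr (_ + _).
under [RHS]eq_bigr => i _ do rewrite -[lam i]card_ord -sum1_card.
rewrite sig_big_dep /=; apply: eq_bigl => p; rewrite andbT.
exact: (satB (inr p : attach_vertex lam)).
Qed.

Lemma card_attach_paths : #|G| = \sum_i (lam i).+1.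
Proof.
by rewrite -cardsT card_saturated => [|x]; [apply: eq_bigl => i|]; rewrite !inE.
Qed.

(** A path meets the rest of the graph only through its base vertex. So a
connected set missing that vertex but meeting the path is contained in the path,
and this is impossible for a set with more vertices than the path. *)
Lemma block_contains_root (B : {set G}) (x : G) :
  connected (induced B) -> (forall i, lam i < #|B|) -> x \in B -> root_of x \in B.
Proof.
move=> conB bigB; case: x => [i|p] xB //; apply: contraLR (bigB (tag p)) => rootB.
rewrite -leqNgt -[lam _]card_ord -cardsT.
pose f (k : 'I_(lam (tag p))) : G := (inr (Tagged _ k) : attach_vertex lam).
apply: leq_trans (leq_imset_card f setT).
apply/subset_leq_card/connected_sub => //; last first.
  exists (inr p) => //; apply/imsetP; exists (tagged p) => //.
  by rewrite /f; case: (p).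
move=> z y _ yB + /imsetP[k _ zE]; rewrite {}zE; move: yB.
case: y => [j|[j l]] yB /= /andP[/eqP tag_eq _].
  by rewrite /root_of /= -tag_eq yB in rootB.
by case: _ / tag_eq l yB => l _; apply/imsetP; exists l.
Qed.

(** If the base vertex of x is in B but x is not, the block of x contains that
base vertex too, although it is disjoint from B. So B is a union of arms. *)
Lemma card_block_dvd (P : {set {set G}}) (m : nat) :
  connected_partition P -> (forall i, m %| (lam i).+1) ->
  (forall B, B \in P -> forall i, lam i < #|B|) ->
  forall B, B \in P -> m %| #|B|.
Proof.
move=> [/and3P[/eqP covP trivP _] conP] dvd_m bigP B BP.
rewrite card_saturated ?dvdn_sum // => x; apply/idP/idP.
  by apply: block_contains_root; [exact: conP|exact: bigP].
have [A AP xA] : exists2 A, A \in P & x \in A.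
  by apply/bigcupP; rewrite -/(cover P) covP inE.
have rA : root_of x \in A by apply: block_contains_root xA; [exact: conP|exact: bigP].
move=> rB; have [<-//|neqAB] := eqVneq A B.
have /trivIsetP/(_ A B AP BP neqAB)/disjointFr/(_ rA) := trivP.
by rewrite rB.
Qed.

Lemma linked_attach_paths : linked (edges H) -> linked (edges G).
Proof.
move=> lH A clA.
have clG (x y : G) : adj x y -> (x \in A) = (y \in A).
  by move=> xy; apply: (clA (x, y)); rewrite mem_edges.
have rootA x : (x \in A) = (root_of x \in A).
  case: x => [//|[i [k ltk]]]; elim: k ltk => [|k IH] ltk.
    by apply/esym/clG; rewrite /= !eqxx.
  rewrite -(IH (ltnW ltk)); apply/esym/clG.
  by rewrite /= !eqxx.
have [|A0|AT] := lH [set i | (inl i : attach_vertex lam) \in A].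
- by move=> [i j]; rewrite mem_edges !inE => ij; apply: clG.
- by left; apply/setP => x; have /setP/(_ (base_vertex x)) := A0; rewrite !inE rootA.
- by right; apply/setP => x; have /setP/(_ (base_vertex x)) := AT; rewrite !inE rootA.
Qed.

End AttachedPaths.

Lemma linked_complete_graph n : linked (edges (complete_graph n)).
Proof. by apply/linked_induced_setT/linked_complete. Qed.

Lemma linked_cycle_graph n : 1 < n -> linked (edges (cycle_graph n)).
Proof.
case: n => [|[|n]] // _ A clA.
have ordSA (i : 'I_n.+2) : (ordS i \in A) = (i \in A).
  have iS : i != ordS i.
    apply/eqP => /(congr1 val) /=; have [i_lt|i_ge] := ltnP i n.+1.
      by rewrite modn_small ?ltnS // => /eqP; rewrite ltn_eqF.
    have -> : i = n.+1 :> nat by apply/eqP; rewrite eqn_leq i_ge -ltnS ltn_ord.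
    by rewrite modnn.
  by apply/esym/(clA (i, ordS i)); rewrite mem_edges /= /cycle_rel iS eqxx.
have A0 (i : 'I_n.+2) : (i \in A) = (ord0 \in A).
  case: i => k; elim: k => [|k IH] ltk; first by congr (_ \in A); exact: val_inj.
  rewrite -(IH (ltnW ltk)) -[RHS]ordSA; congr (_ \in A); apply: val_inj.
  exact/esym/modn_small.
by case A0E: (ord0 \in A); [right|left]; apply/setP => i; rewrite A0 A0E inE.
Qed.

(** * Suns *)

Section NoBipartition.
Variables (H : sgraph) (lam : H -> nat) (m a b : nat).
Hypotheses (dvd_m : forall i, m %| (lam i).+1) (ndvd_b : ~~ (m %| b)).
Hypotheses (lt_lam_b : forall i, lam i < b) (le_ba : b <= a).

Lemma attach_paths_no_connected_partition :
  ~ has_connected_partition (attach_paths lam) [:: a; b].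
Proof.
move=> [P [conP typeP]]; case/negP: ndvd_b.
have bigP B : B \in P -> forall i, lam i < #|B|.
  move=> BP i; have : #|B| \in partition_type P by rewrite mem_sort map_f // mem_enum.
  by rewrite typeP !inE => /orP[] /eqP->; rewrite ?(leq_trans (lt_lam_b i)).
have : b \in partition_type P by rewrite typeP !inE eqxx orbT.
rewrite mem_sort => /mapP[B]; rewrite mem_enum => BP ->.
exact: (card_block_dvd conP dvd_m bigP BP).
Qed.

Lemma attach_paths_not_e_positive :
  linked (edges H) -> \sum_i (lam i).+1 = a + b -> ~ e_positive (attach_paths lam).
Proof.
move=> lH sum_lam epos; apply: attach_paths_no_connected_partition.
have b_gt0 : 0 < b by case: b ndvd_b => //; rewrite dvdn0.
have a_gt0 : 0 < a := leq_trans b_gt0 le_ba.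
have cardG := etrans (card_attach_paths lam) sum_lam.
have [A [Aa Ab cA cC]] := e_positive_connected_bipartition a_gt0 b_gt0 cardG
  (linked_attach_paths lH) epos.
by apply: has_connected_bipartition Aa Ab cA cC; rewrite b_gt0.
Qed.

End NoBipartition.

Theorem theorem3p5 (n : nat) (lam : nat -> nat) (m : nat) (hn : 3 <= n)
    (lam_gt0 : forall i, i < n -> 0 < lam i)
    (lam_max : lam 0 = \max_(0 <= i < n) lam i)
    (gcd_m : \big[gcdn/0]_(0 <= i < n) (lam i + 1) = m)
    (m_gt1 : 1 < m)
    (lam_le : lam 0 + 2 <= \sum_(1 <= i < n) lam i + n - 2) :
  (~ has_connected_partition (sun n lam)
       [:: \sum_(1 <= i < n) lam i + n - 2; lam 0 + 2] /\
   ~ has_connected_partition (complete_sun n lam)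
       [:: \sum_(1 <= i < n) lam i + n - 2; lam 0 + 2]) /\
  (~ e_positive (sun n lam) /\ ~ e_positive (complete_sun n lam)).
Proof.
have n_gt0 : 0 < n := ltnW (ltnW hn).
have dvd_m (i : 'I_n) : m %| (lam i).+1.
  by rewrite -gcd_m big_mkord; apply: (biggcdn_inf i); rewrite ?addn1.
have ndvd_b : ~~ (m %| lam 0 + 2).
  have dvd_0 := dvd_m (Ordinal n_gt0).
  by rewrite addn2 -addn1 dvdn_addr // dvdn1 gtn_eqF.
have lt_lam_b (i : 'I_n) : lam i < lam 0 + 2.
  by rewrite addn2 ltnS leqW // lam_max big_mkord leq_bigmax.
have sum_lam : \sum_(i < n) (lam i).+1 =
    \sum_(1 <= i < n) lam i + n - 2 + (lam 0 + 2).
  under [LHS]eq_bigr do rewrite -addn1.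
  rewrite big_split /= sum1_card card_ord -(big_mkord xpredT lam) big_ltn //.
  have /subnK E : 2 <= \sum_(1 <= i < n) lam i + n.
    by rewrite (leq_trans (ltnW hn)) ?leq_addl.
  by rewrite -addnA -[in LHS]E addnCA addnA.
split; split.
- exact: (@attach_paths_no_connected_partition (cycle_graph n) _ m).
- exact: (@attach_paths_no_connected_partition (complete_graph n) _ m).
- exact: (@attach_paths_not_e_positive (cycle_graph n) _ m _ _ dvd_m ndvd_b
    lt_lam_b lam_le (linked_cycle_graph (ltnW hn)) sum_lam).
- exact: (@attach_paths_not_e_positive (complete_graph n) _ m _ _ dvd_m ndvd_b
    lt_lam_b lam_le (@linked_complete_graph n) sum_lam).
Qed.
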